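(* Suppose that $F\in\operatorname{dom}(D)$ and $G\in\operatorname{dom}(L)$. Then $$\mathbb{E}[F\,LG]=-\mathbb{E}\bigl[\Gamma_0(F,G)\bigr].$$
   Context: Let $(E_n,\mathcal{B}_n,\mu_n)$, $n\in\mathbb{N}$, be probability spaces with product $(E,\mathcal{B},\mu)$. On a probability space $(\Omega,\mathcal{A},\mathbb{P})$ let $\mathbb{X}=(X_n)_{n\in\mathbb{N}}$ and $\mathbb{X}'=(X'_n)_{n\in\mathbb{N}}$ be two independent $E$-valued random sequences, each with distribution $\mu$. For $k\in\mathbb{N}$, $\mathbb{X}^{(k)}$ is obtained from $\mathbb{X}$ by replacing $X_k$ with $X_k'$. Let $\mathcal{F}=\sigma(\mathbb{X})$, $\mathcal{F}_n=\sigma(X_1,\dotsc,X_n)$, $\mathcal{G}_k=\sigma(X_j:j\neq k)$, $L^2_{\mathbb{X}}=L^2(\Omega,\mathcal{F},\mathbb{P})$. A representative of $F\in L^2_{\mathbb{X}}$ is $f\in L^2(\mu)$ with $F=f(\mathbb{X})$ a.s. $\kappa$ is counting measure on $\mathbb{N}$, $\mathbb{P}_{\mathcal F}$ the restriction of $\mathbb{P}$ to $\mathcal{F}$. Malliavin operators: $D_kF:=F-\mathbb{E}[F\mid\mathcal{G}_k]$. On the space of all $F\in L^2_{\mathbb{X}}$ that are $\mathcal{F}_n$-measurable for some $n$, put $DF:=(D_kF)_{k\in\mathbb{N}}\in L^2(\kappa\otimes\mathbb{P}_{\mathcal F})$; this is closable and its closure is denoted $D$ with domain $\operatorname{dom}(D)$.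 Let $\delta$ be the Hilbert space adjoint of $D$, and $\operatorname{dom}(L)=\{F\in\operatorname{dom}(D):DF\in\operatorname{dom}(\delta)\}$, $LF:=-\delta DF$. For $F,G\in\operatorname{dom}(D)$ with representatives $f,g$, $$\Gamma_0(F,G):=\frac12\sum_{k=1}^\infty\mathbb{E}\Bigl[\bigl(f(\mathbb{X}^{(k)})-f(\mathbb{X})\bigr)\bigl(g(\mathbb{X}^{(k)})-g(\mathbb{X})\bigr)\,\Big|\,\mathbb{X}\Bigr],$$ a well-defined element of $L^1(\mathbb{P})$. *)

(* Defs.v *)
From HB Require Import structures.
From mathcomp Require Import all_boot all_order all_algebra.
From mathcomp Require Import all_classical all_reals all_analysis.

Set Implicit Arguments.
Unset Strict Implicit.
Unset Printing Implicit Defensive.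

Import Order.TTheory GRing.Theory Num.Theory.
Import numFieldNormedType.Exports.

Local Open Scope classical_set_scope.
Local Open Scope ring_scope.

(* Elements of L^2 are square-integrable measurable functions, not classes:
   operators are given by their graphs, and equality in L^2 is equality almost
   everywhere. [op_app A f] picks one of the representatives of the value. *)
Section unbounded_operators.
Context (R : realType).

Definition L2 d (T : measurableType d) (m : {measure set T -> \bar R}) :=
  LfunType m (lee1n 2).

Definition inner d (T : measurableType d) (m : {measure set T -> \bar R})
  (f g : L2 m) : R := \int[m]_x (f x * g x).

Definition L2_cvg d (T : measurableType d) (m : {measure set T -> \bar R})
  (u : nat -> L2 m) (f : L2 m) : Prop :=
  ('N[m]_2%:E [EFin \o (fun x => u n x - f x)%R])%E @[n --> \oo] --> 0%E.

Context d1 d2 (T1 : measurableType d1) (T2 : measurableType d2).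
Context (m1 : {measure set T1 -> \bar R}) (m2 : {measure set T2 -> \bar R}).

Definition op_dom (A : set (L2 m1 * L2 m2)) : set (L2 m1) :=
  [set f | exists h, A (f, h)].

Definition op_app (A : set (L2 m1 * L2 m2)) (f : L2 m1) : L2 m2 :=
  xget 0 [set h | A (f, h)].

Definition op_closure (A : set (L2 m1 * L2 m2)) : set (L2 m1 * L2 m2) :=
  [set fh | exists u : nat -> L2 m1 * L2 m2, [/\ forall n, A (u n),
     L2_cvg (fst \o u) fh.1 & L2_cvg (snd \o u) fh.2]].

Definition op_adjoint (A : set (L2 m1 * L2 m2)) : set (L2 m2 * L2 m1) :=
  [set hf | forall g : L2 m1, op_dom A g ->
     inner g hf.2 = inner (op_app A g) hf.1].

End unbounded_operators.

(* [condexp C F] is a version of E[F | <<s C>>]. *)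
Section conditional_expectation.
Context d (T : measurableType d) (R : realType) (P : probability T R).
Local Open Scope ereal_scope.

Definition is_condexp (C : set (set T)) (F H : T -> R) : Prop :=
  [/\ measurable_fun [set: g_sigma_algebraType C] H,
      P.-integrable [set: T] (EFin \o H) &
      forall A, <<s C >> A ->
        \int[P]_(w in A) (H w)%:E = \int[P]_(w in A) (F w)%:E].

Definition condexp (C : set (set T)) (F : T -> R) : T -> R :=
  xget (cst 0%R) (is_condexp C F).

End conditional_expectation.

Section product_space.
Context (d : nat -> measure_display) (E : forall n, measurableType (d n)).

Definition cylinders : set (set (forall n, E n)) :=
  \bigcup_n preimage_set_system setT (fun x : forall m, E m => x n) measurable.

Definition prodE := g_sigma_algebraType cylinders.

Definition is_product_measure (R : realType)
    (mu_ : forall n, probability (E n) R) (mu : probability prodE R) : Prop :=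
  forall (n : nat) (A : forall i, set (E i)), (forall i, measurable (A i)) ->
    mu [set x | forall i, (i < n)%N -> A i (x i)] =
      (\prod_(i < n) mu_ i (A i))%E.

End product_space.

Definition has_distribution d d' (T : measurableType d)
    (T' : measurableType d') (R : realType) (P : probability T R)
    (X : {RV P >-> T'}) (mu : probability T' R) : Prop :=
  forall A, measurable A -> distribution P X A = mu A.

Definition independent2 d d' (T : measurableType d) (T' : measurableType d')
    (R : realType) (P : probability T R) (X Y : {RV P >-> T'}) : Prop :=
  forall A B, measurable A -> measurable B ->
    P (X @^-1` A `&` Y @^-1` B) = (P (X @^-1` A) * P (Y @^-1` B))%E.

Section malliavin.
Context (R : realType) (d : nat -> measure_display)
        (E : forall n, measurableType (d n))
        (d0 : measure_display) (T : measurableType d0) (P : probability T R).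
Context (X : {RV P >-> prodE E}).

(* Generators of sigma(X_j : j \in J). Coordinates are indexed from 0, so
   [cFn n] generates sigma of the first n coordinates. *)
Definition sigX (J : set nat) : set (set T) :=
  \bigcup_(j in J) preimage_set_system setT (fun w => X w j) measurable.

Definition cF := sigX setT.
Definition cFn (n : nat) := sigX `I_n.
Definition cG (k : nat) := sigX [set~ k].

Definition toF (w : T) : g_sigma_algebraType cF := w.

Lemma measurable_toF : measurable_fun [set: T] toF.
Proof.
move=> _ A mA; rewrite setTI.
apply: (@smallest_sub _ (sigma_algebra setT) cF measurable) mA.
  exact: sigma_algebra_measurable.
move=> _ [j _ [B mB <-]].
have mj : measurable ((fun x : prodE E => x j) @^-1` B).
  by apply: sub_gen_smallest; exists j => //; exists B; rewrite ?setTI.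
rewrite setTI; exact: (measurable_funPTI X mj).
Qed.

HB.instance Definition _ := @isMeasurableFun.Build _ _ T
  (g_sigma_algebraType cF) toF measurable_toF.

(* The pushforward along the identity is the restriction of P to sigma(X). *)
Definition PF : probability (g_sigma_algebraType cF) R :=
  distribution P toF.

Definition L2X := L2 PF.

Definition kappaPF : {measure set (nat * g_sigma_algebraType cF) -> \bar R} :=
  (@counting nat R \x PF)%E.

Definition D_ (k : nat) (F : T -> R) : T -> R :=
  fun w => F w - condexp P (cG k) F w.

Definition D0 : set (L2X * L2 kappaPF) :=
  [set FH : L2X * L2 kappaPF |
     (exists n, measurable_fun [set: g_sigma_algebraType (cFn n)]
                               (FH.1 : T -> R)) /\
     forall k, {ae P, forall w, FH.2 (k, w) = D_ k FH.1 w}].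

Definition D := op_closure D0.
Definition domD : set L2X := op_dom D.

Definition delta := op_adjoint D.

Definition domL : set L2X :=
  [set F | domD F /\ op_dom delta (op_app D F)].

Definition L (F : L2X) : L2X := - op_app delta (op_app D F).

Definition representative (mu : probability (prodE E) R) (F : L2X)
    (f : L2 mu) : Prop :=
  {ae P, forall w, F w = f (X w)}.

Context (X' : {RV P >-> prodE E}).

Definition resample (k : nat) (w : T) : prodE E :=
  fun n => if n == k then X' w n else X w n.

(* The series is summed pointwise: for f, g representing elements of [domD] it
   converges almost surely and in L^1, to the same sum. *)
Definition Gamma0 (f g : prodE E -> R) : T -> R :=
  fun w => 2^-1 * limn (series (fun k =>
    condexp P cF (fun w' => (f (resample k w') - f (X w')) *
                            (g (resample k w') - g (X w'))) w)).

End malliavin.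

(* Main.v *)
Require Import Defs.
From HB Require Import structures.
From mathcomp Require Import all_boot all_order all_algebra ring lra.
From mathcomp Require Import all_classical all_reals all_analysis.
From mathcomp Require Import measurable_realfun.

(** For [G] in the domain of [L], the adjoint relation turns [E[F LG]] into
    [- <DF, DG>], an inner product over the product of the counting measure and
    of the restriction of [P] to [sigma(X)].  Everything rests on the identity,
    for each [k],

      [E[(f(X^(k)) - f(X)) (g(X^(k)) - g(X))] = 2 E[D_k F D_k G]]

    of [resampling_covariance].  Given the coordinates other than [k], the
    variables [X_k] and [X'_k] are independent with the law [mu_k], and
    [E[F | G_k]] is the mean of [f] over the [k]-th coordinate.  Conditionally
    on [G_k], the identity thus says that the covariance of two functions is
    half the mean of the product of their increments between two independent
    points ([covariance_resampling]).  The conditioning itself is Fubini's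
    theorem, once the law of ([X_j], [j <> k]), [X_k], [X'_k] is known to be a
    product ([with_coords_law]); this is where the product form of [mu] and the
    independence of [X] and [X'] enter.

    Two limits remain.  First, [D] is only a closure, so it has to be seen that
    the [k]-th slice of [DF] is still [F - E[F | G_k]] ([closure_slice]):
    conditional expectation contracts the [L^1] norm, and on each slice the
    [L^1] norm is bounded by the [L^2] norm over all slices.  In particular the
    value of [D] at [F] does not depend on the approximating sequence.  Second,
    the series defining [Gamma0] must be integrated term by term.  By the
    identity with [F = G], the [L^1] norms of its terms are at most
    [E[(D_k F)^2] + E[(D_k G)^2]], which is summable because [DF] and [DG] are
    square-integrable, so dominated convergence applies
    ([cvg_integral_series]). *)

Set Implicit Arguments.
Unset Strict Implicit.
Unset Printing Implicit Defensive.
Import Order.TTheory GRing.Theory Num.Theory.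
Import numFieldNormedType.Exports.
Local Open Scope classical_set_scope.
Local Open Scope ring_scope.

(** * Square-integrable functions and images of measures *)

Lemma normrM_le_half_sqr (R : realFieldType) (x y : R) :
  `|x * y| <= 2^-1 * x ^+ 2 + 2^-1 * y ^+ 2.
Proof.
rewrite -(real_normK (num_real x)) -(real_normK (num_real y)) normrM.
have := sqr_ge0 (`|x| - `|y|); rewrite sqrrB; lra.
Qed.

Lemma integrableB_EFin d (T : measurableType d) (R : realType)
    (m : {measure set T -> \bar R}) (F G : T -> R) :
  m.-integrable [set: T] (EFin \o F) -> m.-integrable [set: T] (EFin \o G) ->
  m.-integrable [set: T] (EFin \o (F \- G)%R).
Proof.
move=> iF iG.
by rewrite (_ : _ \o _ = (EFin \o F) \- (EFin \o G))%E; [exact: integrableB|].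
Qed.

Lemma ae_eq_integrable d (T : measurableType d) (R : realType)
    (m : {measure set T -> \bar R}) (f g : T -> R) :
  measurable_fun [set: T] g -> {ae m, forall x, f x = g x} ->
  m.-integrable [set: T] (EFin \o f) -> m.-integrable [set: T] (EFin \o g).
Proof.
move=> mg fg fi; apply/integrableP; split; first exact/measurable_EFinP.
have mf : measurable_fun [set: T] f.
  by apply/measurable_EFinP; exact: measurable_int fi.
case/integrableP : fi => _; apply: le_lt_trans.
rewrite le_eqVlt; apply/orP; left; apply/eqP; apply: ae_eq_integral => //.
- by apply/measurable_EFinP; exact: measurableT_comp.
- by apply/measurable_EFinP; exact: measurableT_comp.
- by apply: filterS fg => x /= -> _.
Qed.

Lemma ae_eq_integral_EFin d (T : measurableType d) (R : realType)
    (m : {measure set T -> \bar R}) (f g : T -> R) A : measurable A ->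
  measurable_fun [set: T] f -> measurable_fun [set: T] g ->
  {ae m, forall x, f x = g x} ->
  (\int[m]_(x in A) (f x)%:E = \int[m]_(x in A) (g x)%:E)%E.
Proof.
move=> mA mf mg fg; apply: ae_eq_integral => //.
- exact/measurable_EFinP/measurable_funTS.
- exact/measurable_EFinP/measurable_funTS.
- by apply: filterS fg => x /= -> _.
Qed.

Lemma Lfun2P d (T : measurableType d) (R : realType)
    (m : {measure set T -> \bar R}) (f : T -> R) :
  f \in Lfun m 2%:E <-> measurable_fun [set: T] f /\
    m.-integrable [set: T] (EFin \o (fun x => f x ^+ 2)).
Proof.
split=> [f2|[mf f2]].
  split; last exact: Lfun2_integrable_sqr.
  by move: f2 => /[!inE] /andP[/[!inE]].
rewrite inE; apply/andP; split; first by rewrite inE.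
rewrite inE /= /finite_norm unlock poweR_lty//.
case/integrableP : f2 => _; apply: le_lt_trans.
rewrite le_eqVlt; apply/orP; left; apply/eqP/eq_integral => x _ /=.
by rewrite normrX -powR_mulrn.
Qed.

Lemma Lfun2B d (T : measurableType d) (R : realType)
    (m : {measure set T -> \bar R}) (f g : T -> R) :
  f \in Lfun m 2%:E -> g \in Lfun m 2%:E ->
  (fun x => f x - g x) \in Lfun m 2%:E.
Proof.
have p1 : (1 <= 2%:E :> \bar R)%E by rewrite lee_fin ler1n.
move=> f2 g2.
pose a : LfunType m p1 := Lfun_Sub p1 f2.
pose b : LfunType m p1 := Lfun_Sub p1 g2.
exact: (LfunP (a - b)).
Qed.

(** Hölder's inequality against the constant function 1. *)
Lemma integral_abs_le_Lnorm2 d (T : measurableType d) (R : realType)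
    (P : probability T R) (h : T -> R) : measurable_fun [set: T] h ->
  (\int[P]_w `|h w|%:E <= 'N[P]_2%:E[EFin \o h])%E.
Proof.
move=> mh.
have := @hoelder _ _ _ P h (cst (1 : R)) 2 2 mh (measurable_cst (1 : R))
  (ltr0Sn _ _) (ltr0Sn _ _).
have -> : ('N[P]_2%:E[EFin \o cst (1 : R)%R] = 1)%E.
  by rewrite -[RHS](poweR1r 2^-1) -(probability_setT P); exact: Lnorm_cst1.
rewrite Lnorm1 mule1 => hoel.
apply: le_trans (hoel _).
- rewrite le_eqVlt; apply/orP; left; apply/eqP/eq_integral => w _ /=.
  by rewrite mulr1.
- by field.
Qed.

(** Integration against a measure [m] known to be the law of [Z] only through
    its values on measurable sets: [m] will be a product measure, which is not
    convertible to an image measure. *)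
Section transport.
Context d d' (T : measurableType d) (S : measurableType d') (R : realType).
Context (P : probability T R) (Z : {mfun T >-> S}).
Context (m : {measure set S -> \bar R}).
Hypothesis law : forall A, measurable A -> m A = distribution P Z A.
Local Open Scope ereal_scope.

Lemma ge0_integral_law (h : S -> \bar R) : measurable_fun [set: S] h ->
  (forall s, 0 <= h s) -> \int[m]_s h s = \int[P]_w h (Z w).
Proof.
move=> mh h0; rewrite (eq_measure_integral (distribution P Z)); last first.
  by move=> A mA _; exact: law.
exact: ge0_integral_distribution.
Qed.

Lemma integrable_law (h : S -> \bar R) : measurable_fun [set: S] h ->
  m.-integrable [set: S] h <-> P.-integrable [set: T] (h \o Z).
Proof.
move=> mh; have mah : measurable_fun [set: S] (abse \o h).
  exact: measurableT_comp.
have hE : \int[m]_s `|h s| = \int[P]_w `|h (Z w)|.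
  by apply: (ge0_integral_law mah) => s; exact: abse_ge0.
split => /integrableP[_ hi]; apply/integrableP; split => //.
- exact: (measurableT_comp mh).
- by move: hi; rewrite hE.
- by rewrite hE.
Qed.

Lemma integral_law (h : S -> \bar R) : measurable_fun [set: S] h ->
  P.-integrable [set: T] (h \o Z) -> \int[m]_s h s = \int[P]_w h (Z w).
Proof.
move=> mh hi; rewrite (eq_measure_integral (distribution P Z)); last first.
  by move=> A mA _; exact: law.
exact: integral_distribution.
Qed.

Lemma Lfun2_law (h : S -> R) : measurable_fun [set: S] h ->
  h \in Lfun m 2%:E <-> h \o Z \in Lfun P 2%:E.
Proof.
move=> mh; have mh2 : measurable_fun [set: S] (EFin \o (fun s => h s ^+ 2)%R).
  by apply/measurable_EFinP; exact: measurable_funX.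
split=> /Lfun2P[_ h2]; apply/Lfun2P; split => //.
- exact: measurableT_comp.
- by move/(integrable_law mh2) : h2.
- exact/(integrable_law mh2).
Qed.

End transport.

(** * Conditional expectation *)

Section condexp_theory.
Context d (T : measurableType d) (R : realType) (P : probability T R).
Variables (C : set (set T)) (mC : C `<=` measurable).
Local Open Scope ereal_scope.

Lemma sub_sigma_measurable : <<s C >> `<=` measurable.
Proof.
exact: (smallest_sub (sigma_algebra_measurable T) mC).
Qed.

Lemma measurable_sub_id :
  measurable_fun [set: T] (fun w : T => w : g_sigma_algebraType C).
Proof. by move=> _ A mA; rewrite setTI; exact: sub_sigma_measurable. Qed.

(** The identity, seen as a map onto the same space with the smaller
    sigma-algebra: its law is the restriction of [P]. *)
Definition sub_id : {mfun T >-> g_sigma_algebraType C} :=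
  HB.pack (fun w : T => w : g_sigma_algebraType C)
    (isMeasurableFun.Build _ _ T (g_sigma_algebraType C) _ measurable_sub_id).

Lemma measurable_fun_sub d' (T' : measurableType d') (f : T -> T') :
  measurable_fun [set: g_sigma_algebraType C] f -> measurable_fun [set: T] f.
Proof.
by move=> mf _ A mA; rewrite setTI; apply: sub_sigma_measurable;
  rewrite -[X in _ X]setTI; exact: mf.
Qed.

Lemma integral_sub_id (f : g_sigma_algebraType C -> \bar R) A : <<s C >> A ->
  measurable_fun [set: g_sigma_algebraType C] f -> P.-integrable A f ->
  \int[distribution P sub_id]_(w in A) f w = \int[P]_(w in A) f w.
Proof.
by move=> CA mf fi; rewrite (integral_pushforward measurable_sub_id).
Qed.

Lemma integrable_sub_id (f : g_sigma_algebraType C -> \bar R) :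
  (distribution P sub_id).-integrable [set: g_sigma_algebraType C] f ->
  P.-integrable [set: T] f.
Proof.
move=> /integrableP[mf fi]; apply/integrableP; split.
  exact: measurable_fun_sub.
move: fi; rewrite ge0_integral_distribution//.
exact: measurableT_comp.
Qed.

(** Radon-Nikodym on the smaller sigma-algebra, applied to the signed measure
    of density [F]. *)
Lemma condexp_exists (F : T -> R) : P.-integrable [set: T] (EFin \o F) ->
  exists H, is_condexp P C F H.
Proof.
move=> iF.
pose nu : {charge set T -> \bar R} := induced_charge iF.
(* The charge structure of the image depends on the measurability of the map,
   so [nuC_] is a function of its proof. *)
pose nuC_ : {charge set (g_sigma_algebraType C) -> \bar R} :=
  pushforward nu sub_id.
pose nuC := nuC_ measurable_sub_id.
have dom : nuC `<< distribution P sub_id.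
  apply/null_content_dominatesP => A mA PA0.
  rewrite /nuC /= /pushforward /nu /= /induced_charge.
  apply: null_set_integral => //.
  - exact: sub_sigma_measurable.
  - apply: measurable_funTS; exact: measurable_int iF.
pose h := Radon_Nikodym nuC (distribution P sub_id).
have hfin w : h w \is a fin_num by exact: Radon_Nikodym_fin_num.
have hi : (distribution P sub_id).-integrable [set: g_sigma_algebraType C] h.
  exact: Radon_Nikodym_integrable.
have hE : EFin \o (fine \o h) = h by apply/funext => w /=; rewrite fineK.
have hiT : P.-integrable [set: T] h by exact: integrable_sub_id.
exists (fine \o h); split.
- apply: measurableT_comp => //; exact: measurable_int hi.
- by rewrite hE.
- move=> A CA.
  have mA : measurable A by exact: sub_sigma_measurable.
  transitivity (\int[P]_(w in A) h w).
    by apply: eq_integral => w _; rewrite -[in RHS]hE.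
  rewrite -integral_sub_id//; last 2 first.
  + exact: measurable_int hi.
  + exact: integrableS hiT.
  by rewrite -Radon_Nikodym_integral.
Qed.

Lemma condexpP (F : T -> R) : P.-integrable [set: T] (EFin \o F) ->
  is_condexp P C F (condexp P C F).
Proof. by move=> /condexp_exists; exact: xgetPex. Qed.

Lemma is_condexp0 : is_condexp P C (cst 0%R) (cst 0%R).
Proof. by split => //; exact: integrable0. Qed.

Lemma is_condexpB (F G H K : T -> R) :
  P.-integrable [set: T] (EFin \o F) -> P.-integrable [set: T] (EFin \o G) ->
  is_condexp P C F H -> is_condexp P C G K ->
  is_condexp P C (F \- G)%R (H \- K)%R.
Proof.
move=> iF iG [mH iH HE] [mK iK KE]; split.
- exact: measurable_funB.
- exact: integrableB_EFin.
- move=> A CA; have mA := sub_sigma_measurable CA.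
  have iA h : P.-integrable [set: T] h -> P.-integrable A h.
    exact: integrableS.
  rewrite integralB_EFin//; [|exact: iA..].
  by rewrite integralB_EFin// ?HE ?KE//; exact: iA.
Qed.

(** The set where [H >= 0] belongs to the smaller sigma-algebra, so the
    defining property of [H] may be used on it and on its complement. *)
Lemma le_abs_condexp (F H : T -> R) : P.-integrable [set: T] (EFin \o F) ->
  is_condexp P C F H -> \int[P]_w `|H w|%:E <= \int[P]_w `|F w|%:E.
Proof.
move=> iF FH; have [mH iH HE] := FH.
pose A := [set w | (0 <= H w)%R].
have CA : <<s C >> A.
  have := mH measurableT `[0%R, +oo[%classic (measurable_itv _).
  rewrite setTI; congr (<<s C >> _).
  by apply/seteqP; split => w /=; rewrite in_itv/= andbT.
have CNA : <<s C >> (~` A) by rewrite -setTD; exact: sigma_algebraCD.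
have mA := sub_sigma_measurable CA.
have mNA := sub_sigma_measurable CNA.
have mabs (f : T -> R) B : P.-integrable [set: T] (EFin \o f) -> measurable B ->
    measurable_fun B (fun w => `|f w|%:E).
  move=> fi mB; apply/measurable_EFinP/measurableT_comp => //.
  by apply/measurable_funTS/measurable_EFinP; exact: measurable_int fi.
have le (f : T -> R) B : P.-integrable [set: T] (EFin \o f) -> measurable B ->
    \int[P]_(w in B) (f w)%:E <= \int[P]_(w in B) `|f w|%:E.
  move=> fi mB; apply: le_integral => //=.
  - exact: integrableS fi.
  - by apply: (integrableS measurableT) => //; exact: (integrable_abse fi).
  - by move=> w _; rewrite lee_fin ler_norm.
have disj : [disjoint A & ~` A] by rewrite disj_set2E setICr.
rewrite -(setvU (~` A)) setCK !ge0_integral_setU//=; [|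
  by apply: (mabs _ _ _ (measurableU _ _ mA mNA)) ..].
apply: leeD.
- rewrite (_ : \int[P]_(w in A) _ = \int[P]_(w in A) (H w)%:E); last first.
    by apply: eq_integral => w /[!inE] Aw; rewrite ger0_norm.
  by rewrite HE//; exact: le.
- have i0 : P.-integrable [set: T] (EFin \o cst 0%R) by exact: integrable0.
  have [_ _ NE] := is_condexpB i0 iF is_condexp0 FH.
  rewrite (_ : \int[P]_(w in _) _ =
      \int[P]_(w in ~` A) (0 - H w)%:E); last first.
    apply: eq_integral => w /[!inE] /negP; rewrite -ltNge => Hw.
    by rewrite sub0r ltr0_norm.
  rewrite [leLHS]NE// (le_trans (le _ _ (integrableB_EFin i0 iF) mNA))//.
  apply: ge0_le_integral => //.
  + exact: (mabs _ _ (integrableB_EFin i0 iF)).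
  + exact: mabs.
  + by move=> w _; rewrite /= sub0r normrN.
Qed.

Lemma le_abs_condexpB (F G H K : T -> R) :
  P.-integrable [set: T] (EFin \o F) -> P.-integrable [set: T] (EFin \o G) ->
  is_condexp P C F H -> is_condexp P C G K ->
  \int[P]_w `|H w - K w|%:E <= \int[P]_w `|F w - G w|%:E.
Proof.
move=> iF iG FH GK.
exact: (le_abs_condexp (integrableB_EFin iF iG) (is_condexpB iF iG FH GK)).
Qed.

(** The case [F = G] of the contraction. *)
Lemma condexp_unique (F H K : T -> R) : P.-integrable [set: T] (EFin \o F) ->
  is_condexp P C F H -> is_condexp P C F K -> {ae P, forall w, H w = K w}.
Proof.
move=> iF FH FK; have [mH iH _] := FH; have [mK iK _] := FK.
have mHK : measurable_fun [set: T] (EFin \o (H \- K)%R).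
  by apply/measurable_EFinP/measurable_funB; exact: measurable_fun_sub.
have [ae0 _] := ae_eq_integral_abs P measurableT mHK.
have /ae0 : \int[P]_w `|(EFin \o (H \- K)%R) w| = 0.
  apply/eqP; rewrite eq_le integral_ge0// andbT.
  apply: (le_trans (le_abs_condexpB iF iF FH FK)).
  by under eq_integral do rewrite subrr normr0; rewrite integral0.
apply: filterS => w /(_ I) /= [] /eqP.
by rewrite subr_eq0 => /eqP.
Qed.
End condexp_theory.

(** * Covariance as the effect of resampling *)

(** A covariance is half the mean product of the increments between two
    independent points of the space. *)
Section covariance_by_resampling.
Context d (N : measurableType d) (R : realType) (nu : probability N R).
Variables a b : N -> R.
Hypotheses (ia : nu.-integrable [set: N] (EFin \o a))
  (ib : nu.-integrable [set: N] (EFin \o b))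
  (iab : nu.-integrable [set: N] (EFin \o (a \* b))).

Local Notation Ea := (\int[nu]_x a x).
Local Notation Eb := (\int[nu]_x b x).
Local Notation Eab := (\int[nu]_x (a x * b x)).

Let shift_mulE (p q : R) : (fun x => (a x - p) * (b x - q)) =
  ((a \* b) \- (fun x => p * b x)) \- ((fun x => q * a x) \- cst (p * q)).
Proof. by apply/funext => x /=; ring. Qed.

Let ipb (p : R) : nu.-integrable [set: N] (EFin \o (fun x => p * b x)).
Proof. exact: (integrableZl measurableT p ib). Qed.

Let iqa (q : R) : nu.-integrable [set: N] (EFin \o (fun x => q * a x)).
Proof. exact: (integrableZl measurableT q ia). Qed.

Let ic (c : R) : nu.-integrable [set: N] (EFin \o cst c).
Proof. exact: finite_measure_integrable_cst. Qed.

Let integrable_shift_mul (p q : R) :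
  nu.-integrable [set: N] (EFin \o (fun x => (a x - p) * (b x - q))).
Proof. by rewrite shift_mulE; do 2?apply: integrableB_EFin. Qed.

Lemma integral_shift_mul (p q : R) :
  (\int[nu]_x ((a x - p) * (b x - q))%:E =
   (Eab - p * Eb - q * Ea + p * q)%:E)%E.
Proof.
(* Both sides are finite, so the expansion is done on real-valued integrals. *)
rewrite -[LHS]fineK; last exact: integrable_fin_num (integrable_shift_mul p q).
congr EFin; rewrite -[LHS]/(\int[nu]_x (fun x => (a x - p) * (b x - q)) x).
rewrite shift_mulE RintegralB//; [|by do 1?apply: integrableB_EFin..].
rewrite RintegralB// RintegralB// RintegralZl// RintegralZl//.
rewrite Rintegral_cst// [X in fine X]probability_setT mulr1; ring.
Qed.

Lemma covariance_resampling :
  (\int[nu]_x \int[nu]_y ((a y - a x) * (b y - b x))%:E =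
   2%:E * \int[nu]_x ((a x - Ea) * (b x - Eb))%:E)%E.
Proof.
under eq_integral do rewrite integral_shift_mul.
transitivity (\int[nu]_x (((a x - Ea) * (b x - Eb)) +
    cst (Eab - Ea * Eb) x)%:E)%E.
  by apply: eq_integral => x _ /=; congr EFin; ring.
have intc (c : R) : (\int[nu]_x (EFin \o cst c) x = c%:E)%E.
  by rewrite -[RHS]mule1 -(probability_setT nu) -integral_cst.
rewrite integralD_EFin// [X in (_ + X)%E]intc integral_shift_mul.
by rewrite -EFinD -EFinM; congr EFin; ring.
Qed.
End covariance_by_resampling.

(** The same identity with a parameter [s] in [S], integrated over [s]: the
    increments are taken in the second variable only. *)
Section fresh_noise.
Context d1 d2 (S : measurableType d1) (N : measurableType d2) (R : realType).
Context (m : probability S R) (nu : probability N R).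
Local Notation M := (m \x nu)%E.
Variables a b : S * N -> R.
Hypotheses (a2 : a \in Lfun M 2%:E) (b2 : b \in Lfun M 2%:E).

Definition noise_mean (c : S * N -> R) (s : S) : R := \int[nu]_z c (s, z).

Hypothesis icov : M.-integrable [set: S * N] (EFin \o (fun x =>
  (a x - noise_mean a x.1) * (b x - noise_mean b x.1))).
Hypothesis ires : (M \x nu)%E.-integrable [set: S * N * N] (EFin \o (fun y =>
  (a (y.1.1, y.2) - a y.1) * (b (y.1.1, y.2) - b y.1))).

Lemma covariance_fresh_noise :
  (\int[M \x nu]_y ((a (y.1.1, y.2) - a y.1) * (b (y.1.1, y.2) - b y.1))%:E =
   2%:E * \int[M]_x ((a x - noise_mean a x.1) * (b x - noise_mean b x.1))%:E)%E.
Proof.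
have fM : M setT \is a fin_num by rewrite probability_setT.
have a1 := Lfun_subset12 fM a2.
have b1 := Lfun_subset12 fM b2.
have /Lfun1_integrable iab := Lfun2_mul_Lfun1 a2 b2.
move: a1 b1 => /Lfun1_integrable ia /Lfun1_integrable ib.
(* Giving the factors avoids a costly search for the product structure. *)
pose Mp := [the probability _ _ of (m \x nu)%E].
have iF := @integrable_fubini_F _ _ _ _ _ Mp nu _ ires.
have E1 := @integral12_prod_meas1 _ _ _ _ _ Mp nu _ ires.
have E2 := integral12_prod_meas1 iF.
have E3 := integral12_prod_meas1 icov.
apply: (etrans (esym E1)); apply: (etrans (esym E2)).
apply: (etrans _ (congr1 (fun x => 2%:E * x)%E E3)).
have iG := integrable_fubini_F icov.
apply: (etrans _ (integralZl measurableT iG 2)).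
apply: ae_eq_integral => //.
- exact: measurable_fubini_F iF.
- apply: measurable_funeM; exact: measurable_fubini_F icov.
- have := ae_integrable1 ia; have := ae_integrable1 ib.
  have := ae_integrable1 iab.
  apply: filterS3 => s iabs ibs ias _.
  exact: (@covariance_resampling _ _ _ nu
    (fun z => a (s, z)) (fun z => b (s, z))).
Qed.
End fresh_noise.

(** * Series of integrable functions *)

Lemma le_nneseries_term (R : realType) (u : nat -> \bar R) k :
  (forall n, 0 <= u n)%E -> (u k <= \sum_(n <oo) u n)%E.
Proof.
move=> u0.
apply: le_trans (nneseries_lim_ge k.+1 _) => [|n _ _]; last exact: u0.
by rewrite big_nat_recr//= leeDr// sume_ge0.
Qed.

Lemma cvg_summable (R : realType) (a : nat -> R) :
  (\sum_(k <oo) `|a k|%:E < +oo)%E ->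
  (\sum_(0 <= k < n) (a k)%:E)%E @[n --> \oo] --> (\sum_(k <oo) (a k)%:E)%E.
Proof.
move=> suma.
have cs : cvgn (series a).
  by apply: normed_cvg; apply: nnseries_is_cvg => [k|]; first exact: normr_ge0.
have cE : (\sum_(0 <= k < n) (a k)%:E)%E @[n --> \oo] --> (limn (series a))%:E.
  under eq_fun do rewrite sumEFin.
  by apply/fine_cvgP; split; [exact: nearW|exact: cs].
by rewrite (cvg_lim _ cE).
Qed.

Section series_of_integrable.
Context d (T : measurableType d) (R : realType).

(** A formula for [limn u] valid also when [u] diverges, where [limn u] is a
    default value; it reduces the measurability of a limit to that of upper and
    lower limits. *)
Lemma limn_esup_einfE (u : nat -> R) :
  limn u = if (limn_esup (EFin \o u) == limn_einf (EFin \o u)) &&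
              (limn_esup (EFin \o u) \is a fin_num)
           then fine (limn_esup (EFin \o u)) else point.
Proof.
have [cu|ncu] := pselect (cvgn u).
  have cEu : EFin \o u @ \oo --> (limn u)%:E.
    by apply/fine_cvgP; split => //; exact: nearW.
  by have [-> ->] := cvg_limn_einf_sup cEu; rewrite eqxx.
case: ifPn => [/andP[/eqP es_ei es_fin]|_]; last exact: dvgP.
exfalso; apply: ncu; apply/cvg_ex; exists (fine (limn_esup (EFin \o u))).
suff : EFin \o u @ \oo --> (fine (limn_esup (EFin \o u)))%:E.
  by move=> /fine_cvgP[].
rewrite fineK//.
have cs := @is_cvg_esups _ (EFin \o u); have ci := @is_cvg_einfs _ (EFin \o u).
apply: (@squeeze_cvge _ _ _ _ (einfs (EFin \o u)) _ (esups (EFin \o u))).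
- apply: nearW => n; apply/andP; split.
  + by apply: ereal_inf_lbound; exists n => /=.
  + by apply: ereal_sup_ubound; exists n => /=.
- by rewrite es_ei limn_einf_lim.
- by rewrite limn_esup_lim.
Qed.

Lemma measurable_fun_limn (u : nat -> T -> R) :
  (forall n, measurable_fun [set: T] (u n)) ->
  measurable_fun [set: T] (fun w => limn (u ^~ w)).
Proof.
move=> mu; have mEu n : measurable_fun [set: T] (EFin \o u n).
  by apply/measurable_EFinP.
have mes : measurable_fun [set: T] (fun w => limn_esup (EFin \o u ^~ w)).
  exact: (measurable_fun_limn_esup mEu).
have mei : measurable_fun [set: T] (fun w => limn_einf (EFin \o u ^~ w)).
  rewrite /limn_einf; apply: (@measurableT_comp _ _ _ _ _ _ -%E) => //.
  apply: (measurable_fun_limn_esup (f := fun n w => (- (u n w)%:E)%E)) => n.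
  by apply: measurableT_comp (mEu n).
under eq_fun do rewrite limn_esup_einfE.
apply: measurable_fun_ifT => //; last exact: measurableT_comp.
apply: measurable_and; first exact: measurable_fun_eqe.
apply: (measurable_fun_bool true) => /=.
exact: (emeasurable_fin_num measurableT mes).
Qed.

Context (P : {measure set T -> \bar R}).
Local Open Scope ereal_scope.

(** The series of absolute values dominates the partial sums, and it is finite
    almost everywhere because it is integrable. *)
Lemma cvg_integral_series (h : nat -> T -> R) :
  (forall k, P.-integrable [set: T] (EFin \o h k)) ->
  \sum_(k <oo) \int[P]_w `|h k w|%:E < +oo ->
  P.-integrable [set: T] (fun w => (limn (series (h ^~ w)))%:E) /\
  (\sum_(0 <= k < n) \int[P]_w (h k w)%:E)%E @[n --> \oo] -->
    \int[P]_w (limn (series (h ^~ w)))%:E.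
Proof.
move=> ih sumh.
have mh k : measurable_fun [set: T] (h k).
  by apply/measurable_EFinP; exact: measurable_int (ih k).
have mabs k : measurable_fun [set: T] (fun w => `|h k w|%:E).
  by apply/measurable_EFinP; exact: measurableT_comp.
pose g w := \sum_(k <oo) `|h k w|%:E.
have ig : P.-integrable [set: T] g.
  apply/integrableP; split; first exact: ge0_emeasurable_sum.
  under eq_integral do rewrite gee0_abs ?nneseries_ge0//.
  by rewrite integral_nneseries.
have mser n : measurable_fun [set: T] (fun w => series (h ^~ w) n).
  by apply: measurable_sum.
have [|||||iL _ cL] := @dominated_convergence _ T R P setT measurableT
   (fun n w => (series (h ^~ w) n)%:E) (fun w => (limn (series (h ^~ w)))%:E) g.
- by move=> n; apply/measurable_EFinP.
- by apply/measurable_EFinP; exact: measurable_fun_limn.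
- have := integrable_ae measurableT ig; apply: filterS => w /(_ I) gfin _.
  have cs : cvgn (series (h ^~ w)).
    apply: normed_cvg; apply: nnseries_is_cvg => [k|]; first exact: normr_ge0.
    have g0 : 0 <= g w by exact: nneseries_ge0.
    by rewrite (ge0_fin_numE g0) in gfin; exact: gfin.
  apply/fine_cvgP; split; first exact: nearW.
  exact: cs.
- by [].
- apply: aeW => w n _ /=.
  apply: (le_trans _ (nneseries_lim_ge n _)) => //.
  by rewrite sumEFin lee_fin; exact: ler_norm_sum.
split => //; apply: cvg_trans cL; apply: near_eq_cvg; apply: nearW => n.
rewrite -(integral_sum measurableT)//; apply: eq_integral => w _.
by rewrite sumEFin.
Qed.
End series_of_integrable.

(** * Functions on a product with the counting measure *)

(** Fubini's theorem below has the counting measure as its first factor. *)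
HB.instance Definition _ (R : realType) :=
  @Measure_isSigmaFinite.Build _ nat R (@counting nat R)
    (sigma_finite_counting R).

Section slices.
Context d (T : measurableType d) (R : realType) (Q : probability T R).
Local Notation K := (@counting nat R \x Q)%E.

(** By Tonelli the integral of [W^2] is the sum of the integrals of the squared
    slices, and one term is at most the sum. *)
Lemma Lnorm2_slice (W : nat * T -> R) k :
  measurable_fun [set: nat * T] W ->
  ('N[Q]_2%:E[EFin \o (fun w => W (k, w))] <= 'N[K]_2%:E[EFin \o W])%E.
Proof.
move=> mW; have mW2 : measurable_fun [set: nat * T]
    (fun x => (`|(EFin \o W) x| `^ 2)%E).
  rewrite (_ : (fun _ => _) = EFin \o (fun x => `|W x| `^ 2)); last first.
    by apply/funext => x.
  apply/measurable_EFinP/(@measurableT_comp _ _ _ _ _ _ (@powR R ^~ 2)) => //.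
  exact: measurableT_comp.
rewrite unlock gt0_ler_poweR//.
- by rewrite in_itv/= leey integral_ge0// => x _; exact: poweR_ge0.
- by rewrite in_itv/= leey integral_ge0// => x _; exact: poweR_ge0.
- rewrite [leRHS](_ : _ =
      (\sum_(j <oo) \int[Q]_w (`|(EFin \o W) (j, w)| `^ 2))%E); last first.
    have E := fubini_tonelli1 (m1 := @counting nat R) (m2 := Q) _ mW2
      (fun x => poweR_ge0 _ _).
    apply: (etrans E); apply: ge0_integral_count => j.
    by apply: integral_ge0 => x _; exact: poweR_ge0.
  apply: (@le_nneseries_term _
    (fun j => \int[Q]_w (`|(EFin \o W) (j, w)| `^ 2))%E k) => j.
  by apply: integral_ge0 => x _; exact: poweR_ge0.
Qed.

Lemma Lfun2_slice (W : nat * T -> R) k :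
  W \in Lfun K 2%:E -> (fun w => W (k, w)) \in Lfun Q 2%:E.
Proof.
move=> W2; case/Lfun2P : (W2) => mW _; move: W2.
rewrite !inE => /andP[_ /[!inE] fW]; apply/andP; split; rewrite inE /=.
  exact: measurable_fun_pair2.
exact: le_lt_trans (Lnorm2_slice k mW) fW.
Qed.

Lemma sum_integral_slices (W : nat * T -> R) :
  K.-integrable [set: nat * T] (EFin \o W) ->
  (\sum_(k <oo) \int[Q]_w `|W (k, w)|%:E < +oo)%E /\
  (\sum_(0 <= k < n) \int[Q]_w (W (k, w))%:E)%E @[n --> \oo] -->
    (\int[K]_x (W x)%:E)%E.
Proof.
move=> iW.
have mW : measurable_fun [set: nat * T] W.
  by apply/measurable_EFinP; exact: measurable_int iW.
have mabs : measurable_fun [set: nat * T] (fun x => `|W x|%:E).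
  by apply/measurable_EFinP; exact: measurableT_comp.
have sumW : (\sum_(k <oo) \int[Q]_w `|W (k, w)|%:E < +oo)%E.
  have := fubini_tonelli1 (m1 := @counting nat R) (m2 := Q) _ mabs
      (fun x => normr_ge0 (W x)).
  rewrite [X in _ = X]ge0_integral_count => [E|k]; last exact: integral_ge0.
  rewrite -[ltLHS]E.
  by case/integrableP : iW.
split => //.
pose a k := (\int[Q]_w W (k, w)).
have iWk k : Q.-integrable [set: T] (fun w => (W (k, w))%:E).
  apply/integrableP; split.
    by apply/measurable_EFinP; exact: measurable_fun_pair2.
  apply: le_lt_trans sumW.
  by apply: (@le_nneseries_term _ (fun k => \int[Q]_w `|W (k, w)|%:E)%E) => j;
    exact: integral_ge0.
have aE k : (\int[Q]_w (W (k, w))%:E = (a k)%:E)%E.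
  by rewrite fineK//; exact: integrable_fin_num.
have suma : (\sum_(k <oo) `|a k|%:E < +oo)%E.
  apply: le_lt_trans sumW; apply: lee_nneseries => [//|k _].
  have -> : `|a k|%:E = `|\int[Q]_w (W (k, w))%:E|%E by rewrite aE.
  by apply: le_abse_integral => //; exact: measurable_int (iWk k).
have <- : (\sum_(k <oo) (a k)%:E = \int[K]_x (W x)%:E)%E.
  have E := integral12_prod_meas1 (m1 := @counting nat R) (m2 := Q) iW.
  apply: (etrans _ E); rewrite /fubini_F /= integral_count.
    by apply: eq_eseriesr => k _; rewrite aE.
  rewrite /summable -nneseries_esumT//.
  by under eq_eseriesr do rewrite aE.
under eq_fun do under eq_bigr do rewrite aE.
exact: cvg_summable.
Qed.
End slices.

(** * Sequences of independent coordinates *)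

Section sequence_space.
Context (d : nat -> measure_display) (E : forall n, measurableType (d n)).

Lemma measurable_coord n :
  measurable_fun [set: prodE E] (fun x : prodE E => x n).
Proof.
move=> _ A mA; rewrite setTI; apply: sub_gen_smallest; exists n => //.
by exists A => //; rewrite setTI.
Qed.

Lemma measurable_fun_prodE d' (S : measurableType d') (h : S -> prodE E) :
  (forall n, measurable_fun [set: S] (fun s => h s n)) ->
  measurable_fun [set: S] h.
Proof.
move=> mh.
apply: (@measurability _ _ S (prodE E) setT h (@cylinders d E)) => //.
move=> _ [_ [n _ [A mA <-]] <-]; rewrite !setTI.
by rewrite -[X in measurable X]setTI; exact: mh.
Qed.

Context (R : realType) (mu_ : forall n, probability (E n) R).

Lemma product_measure_box (mu : probability (prodE E) R) (n : nat)
    (A : forall i, set (E i)) : is_product_measure mu_ mu ->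
  (forall i, measurable (A i)) -> (forall i, (n <= i)%N -> A i = setT) ->
  mu [set x | forall i, A i (x i)] = (\prod_(i < n) mu_ i (A i))%E.
Proof.
move=> mu_prod mA AT; rewrite -mu_prod//; congr (mu _).
apply/seteqP; split => x /= Ax i; first by move=> _; exact: Ax.
by have [/Ax//|/AT ->] := ltnP i n.
Qed.

Lemma measurable_box (A : forall i, set (E i)) :
  (forall i, measurable (A i)) ->
  measurable ([set x | forall i, A i (x i)] : set (prodE E)).
Proof.
move=> mA; rewrite (_ : mkset _ =
    \bigcap_i ((fun x : prodE E => x i) @^-1` A i)); last first.
  by apply/seteqP; split => x /= Ax i; [move=> _; exact: Ax|exact: Ax].
apply: bigcapT_measurable => i; rewrite -[X in measurable X]setTI.
exact: measurable_coord.
Qed.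

End sequence_space.

Section coordinates.
Context (R : realType) (d : nat -> measure_display)
  (E : forall n, measurableType (d n)).
Context (d0 : measure_display) (T : measurableType d0) (P : probability T R).
Context (X : {RV P >-> prodE E}).

Lemma measurable_RV_coord n : measurable_fun [set: T] (fun w => X w n).
Proof. exact: (measurableT_comp (@measurable_coord _ E n)). Qed.

Lemma sigX_measurable J : sigX X J `<=` measurable.
Proof.
move=> _ [n _ [A mA <-]]; exact: measurable_RV_coord.
Qed.

Lemma measurable_sigX_coord J n : J n ->
  measurable_fun [set: g_sigma_algebraType (sigX X J)]
    (fun w : g_sigma_algebraType (sigX X J) => X w n).
Proof.
move=> Jn _ A mA; rewrite setTI; apply: sub_gen_smallest; exists n => //.
by exists A => //; rewrite setTI.
Qed.

(** Turns events of [sigma(X)] into a form to which the independence of [X] and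
    [X'] applies. *)
Lemma cF_preimage A : <<s cF X >> A -> exists2 B, measurable B & A = X @^-1` B.
Proof.
move=> FA; suff [B mB <-] : preimage_set_system setT X measurable A.
  by exists B => //; rewrite setTI.
apply: (@smallest_sub _ (sigma_algebra setT) (cF X)) FA.
- apply: sigma_algebra_preimage; exact: sigma_algebra_measurable.
- move=> _ [n _ [B mB <-]]; exists ((fun x : prodE E => x n) @^-1` B) => //.
  by rewrite -[X in measurable X]setTI; exact: measurable_coord.
Qed.

Lemma sub_cG_cF k : <<s cG X k >> `<=` <<s cF X >>.
Proof.
apply: smallest_sub; first exact: smallest_sigma_algebra.
by move=> A [n _ XA]; apply: sub_gen_smallest; exists n.
Qed.

Context (mu_ : forall n, probability (E n) R) (mu : probability (prodE E) R).
Hypotheses (mu_prod : is_product_measure mu_ mu) (X_mu : has_distribution X mu).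

Lemma RV_box (n : nat) (A : forall i, set (E i)) :
  (forall i, measurable (A i)) -> (forall i, (n <= i)%N -> A i = setT) ->
  P [set w | forall i, A i (X w i)] = (\prod_(i < n) mu_ i (A i))%E.
Proof.
move=> mA AT; rewrite -(product_measure_box mu_prod)// -X_mu//.
exact: measurable_box.
Qed.

Lemma measurable_dfwith (A : forall i, set (E i)) k (B : set (E k)) :
  (forall i, measurable (A i)) -> measurable B ->
  forall i, measurable (eqtype.dfwith A B i).
Proof. by move=> mA mB i; case: eqtype.dfwithP. Qed.

Lemma box_dfwith (A : forall i, set (E i)) k (B : set (E k)) : A k = setT ->
  [set w | forall i : nat, eqtype.dfwith A B i (X w i)] =
  [set w | forall i, A i (X w i)] `&` (fun w => X w k) @^-1` B.
Proof.
move=> AkT; apply/seteqP; split => w /=.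
  move=> AB; split; last by have := AB k; rewrite eqtype.dfwith_in.
  move=> i; have [<-|ki] := eqVneq k i; first by rewrite AkT.
  by have := AB i; rewrite eqtype.dfwith_out.
by move=> [Aw Bw] i; case: eqtype.dfwithP.
Qed.

(** Independence of the [k]-th coordinate from a box in the others: constraining
    also the [k]-th coordinate adds one factor to the product of [RV_box]. *)
Lemma RV_box_indep (k n : nat) (A : forall i, set (E i)) (B : set (E k)) :
  (forall i, measurable (A i)) -> (forall i, (n <= i)%N -> A i = setT) ->
  A k = setT -> measurable B ->
  P ([set w | forall i, A i (X w i)] `&` (fun w => X w k) @^-1` B) =
  (P [set w | forall i, A i (X w i)] * mu_ k B)%E.
Proof.
move=> mA AT AkT mB.
(* The box must be described by enough coordinates to include the [k]-th. *)
pose m := maxn n k.+1.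
have km : (k < m)%N by rewrite leq_max leqnn orbT.
have ATm i : (m <= i)%N -> A i = setT.
  by rewrite geq_max => /andP[/AT].
rewrite [in RHS](@RV_box m)// -box_dfwith// (@RV_box m); last 2 first.
- exact: (measurable_dfwith mA mB).
- move=> i mi; rewrite eqtype.dfwith_out ?ATm//.
  by apply: contraTneq mi => <-; rewrite -ltnNge.
rewrite (bigD1 (Ordinal km))//= [in RHS](bigD1 (Ordinal km))//=.
rewrite eqtype.dfwith_in AkT probability_setT mul1e muleC; congr (_ * _)%E.
apply: eq_bigr => i; rewrite -val_eqE /= eq_sym => ki.
by rewrite eqtype.dfwith_out.
Qed.

Lemma RV_coord_law k (B : set (E k)) : measurable B ->
  P ((fun w => X w k) @^-1` B) = mu_ k B.
Proof.
move=> mB; have := @RV_box_indep k 0 (fun i => setT) B.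
rewrite (_ : mkset _ = setT); last by apply/seteqP; split.
by rewrite setTI probability_setT mul1e => ->.
Qed.

(** A generator of [G_k] that is stable under intersection, as uniqueness of
    measures requires; the generator [cG X k] constrains one coordinate at a
    time and is not. *)
Definition boxes_off (k : nat) : set (set T) :=
  [set C | exists A : forall i, set (E i), [/\ forall i, measurable (A i),
     A k = setT, exists n, forall i, (n <= i)%N -> A i = setT &
     C = [set w | forall i, A i (X w i)]]].

Lemma boxes_off_setT k : boxes_off k setT.
Proof.
exists (fun=> setT); split => //; first by exists 0%N.
by apply/seteqP; split.
Qed.

Lemma boxes_offI k : setI_closed (boxes_off k).
Proof.
move=> _ _ [A [mA Ak [n An] ->]] [B [mB Bk [m Bm] ->]].
exists (fun i => A i `&` B i); split.
- by move=> i; exact: measurableI.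
- by rewrite Ak Bk setTI.
- exists (maxn n m) => i; rewrite geq_max => /andP[ni mi].
  by rewrite An// Bm// setTI.
- apply/seteqP; split => w /=; first by move=> [Aw Bw] i; split.
  by move=> AB; split => i; case: (AB i).
Qed.

Lemma cG_boxes_off k : <<s cG X k >> = <<s boxes_off k >>.
Proof.
apply/seteqP; split; apply: smallest_sub; try exact: smallest_sigma_algebra.
- move=> _ [j jk [B mB <-]]; rewrite setTI; apply: sub_gen_smallest.
  exists (eqtype.dfwith (fun i : nat => [set: E i]) B); split.
  + exact: measurable_dfwith.
  + by rewrite eqtype.dfwith_out//; apply/eqP.
  + exists j.+1 => i ji; rewrite eqtype.dfwith_out//.
    by apply: contraTneq ji => <-; rewrite -ltnNge.
  + rewrite box_dfwith// (_ : mkset _ = setT) ?setTI//.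
    by apply/seteqP; split.
- move=> _ [A [mA Ak _ ->]].
  rewrite (_ : mkset _ = \bigcap_i ((fun w => X w i) @^-1` A i)); last first.
    by apply/seteqP; split => x /= Ax i; [move=> _; exact: Ax|exact: Ax].
  apply: (@bigcapT_measurable _ (g_sigma_algebraType (cG X k))) => i.
  have [ik|ik] := eqVneq i k.
    by rewrite ik Ak preimage_setT; exact: measurableT.
  apply: sub_gen_smallest; exists i.
    by move=> /= ik'; rewrite ik' eqxx in ik.
  by exists (A i) => //; rewrite setTI.
Qed.

(** Both sides are finite measures in [A] that agree on [boxes_off k]. *)
Lemma coord_indep_cG k (A : set T) (B : set (E k)) : <<s cG X k >> A ->
  measurable B ->
  P (A `&` (fun w => X w k) @^-1` B) = (P A * mu_ k B)%E.
Proof.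
move=> GA mB.
pose S := g_sigma_algebraType (cG X k).
have mXB : measurable ((fun w => X w k) @^-1` B).
  by rewrite -[X in measurable X]setTI; exact: measurable_RV_coord.
have mid := measurable_sub_id (@sigX_measurable [set~ k]).
pose m1_ : {measure set S -> \bar R} :=
  pushforward (mrestr P mXB) (sub_id (@sigX_measurable [set~ k])).
pose m1 := m1_ mid.
pose m2 : {measure set S -> \bar R} := mscale
  (NngNum (fine_ge0 (measure_ge0 (mu_ k) B)))
  (distribution P (sub_id (@sigX_measurable [set~ k]))).
have m2E C : m2 C = (P C * mu_ k B)%E.
  by rewrite /m2 /= /mscale /= muleC fineK// fin_num_measure.
rewrite -m2E -[LHS]/(m1 A).
apply: (@measure_unique _ R S (boxes_off k) (fun=> setT) _ _ _ _ m1 m2) => //.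
- exact: cG_boxes_off.
- exact: boxes_offI.
- by move=> _; exact: boxes_off_setT.
- by rewrite bigcup_const.
- move=> _ [C [mC Ck [n Cn] ->]]; rewrite m2E; exact: RV_box_indep Cn Ck mB.
- move=> _; rewrite -[ltLHS]/(P (setT `&` _)).
  by rewrite ltey_eq fin_num_measure// setTI.
Qed.

End coordinates.

(** * Resampling one coordinate *)

Section resampling.
Context (R : realType) (d : nat -> measure_display)
  (E : forall n, measurableType (d n)) (mu_ : forall n, probability (E n) R)
  (mu : probability (prodE E) R) (mu_prod : is_product_measure mu_ mu)
  (d0 : measure_display) (T : measurableType d0) (P : probability T R)
  (X X' : {RV P >-> prodE E}).
Hypotheses (X_mu : has_distribution X mu) (X'_mu : has_distribution X' mu)
  (X_X'_indep : independent2 X X').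
Variable k : nat.

(** The sample space with the sigma-algebra of the coordinates other than [k].
    It plays the role of the space of these coordinates. *)
Definition T_off := g_sigma_algebraType (cG X k).

Definition to_off : {mfun T >-> T_off} :=
  sub_id (@sigX_measurable _ _ _ _ _ P X [set~ k]).

Definition P_off : probability T_off R := distribution P to_off.

Definition with_coord (Y : {RV P >-> prodE E}) (w : T) : T_off * E k :=
  (w, Y w k).

Lemma measurable_with_coord Y : measurable_fun [set: T] (with_coord Y).
Proof.
by apply: measurable_fun_pair; [exact: measurable_funPT to_off|
  exact: measurable_RV_coord].
Qed.

HB.instance Definition _ Y := isMeasurableFun.Build _ _ T (T_off * E k)%type
  (with_coord Y) (measurable_with_coord Y).

Lemma with_coord_law (Y : {RV P >-> prodE E}) :
  (forall (A : set T) (B : set (E k)), <<s cG X k >> A -> measurable B ->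
    P (A `&` (fun w => Y w k) @^-1` B) = (P A * mu_ k B)%E) ->
  forall A, measurable A ->
    (P_off \x mu_ k)%E A = distribution P (with_coord Y) A.
Proof.
move=> Y_indep; apply: product_measure_unique => A B mA mB.
exact: Y_indep.
Qed.

(** The [k]-th coordinate of [X] is independent of the other ones. *)
Lemma with_coord_X_law A : measurable A ->
  (P_off \x mu_ k)%E A = distribution P (with_coord X) A.
Proof.
apply: with_coord_law => {}A B; exact: (coord_indep_cG mu_prod X_mu).
Qed.

Lemma indep_X' (A : set T) (B : set (E k)) : <<s cF X >> A -> measurable B ->
  P (A `&` (fun w => X' w k) @^-1` B) = (P A * mu_ k B)%E.
Proof.
move=> /cF_preimage[C mC ->] mB.
have mB' : measurable ((fun x : prodE E => x k) @^-1` B).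
  by rewrite -[X in measurable X]setTI; exact: measurable_coord.
rewrite -(RV_coord_law mu_prod X'_mu mB); exact: (X_X'_indep mC mB').
Qed.

Lemma with_coord_X'_law A : measurable A ->
  (P_off \x mu_ k)%E A = distribution P (with_coord X') A.
Proof.
apply: with_coord_law => {}A B GA; apply: indep_X'; exact: sub_cG_cF GA.
Qed.

Definition with_coords (w : T) : T_off * E k * E k := (with_coord X w, X' w k).

Lemma measurable_with_coords : measurable_fun [set: T] with_coords.
Proof.
by apply: measurable_fun_pair; [exact: measurable_with_coord|
  exact: measurable_RV_coord].
Qed.

HB.instance Definition _ := isMeasurableFun.Build _ _ T (T_off * E k * E k)%type
  with_coords measurable_with_coords.

(** The [k]-th coordinates of [X] and [X'] are independent with law [mu_ k], and
    independent of the other coordinates of [X]. *)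
Lemma with_coords_law A : measurable A ->
  (P_off \x mu_ k \x mu_ k)%E A = distribution P with_coords A.
Proof.
pose M := [the probability _ _ of (P_off \x mu_ k)%E].
apply: (@product_measure_unique _ _ _ _ _ M (mu_ k)) => {}A B mA mB.
transitivity (P (with_coord X @^-1` A `&` (fun w => X' w k) @^-1` B)) => //.
rewrite indep_X'//; first by congr (_ * _)%E; exact/esym/with_coord_X_law.
have mX : measurable_fun [set: g_sigma_algebraType (cF X)]
    (fun w : g_sigma_algebraType (cF X) => with_coord X w).
  apply: measurable_fun_pair; last exact: measurable_sigX_coord.
  move=> _ C mC; rewrite setTI; change (<<s cF X >> C).
  exact: (sub_cG_cF mC).
by have := mX measurableT A mA; rewrite setTI.
Qed.

(** Both [X] and its resampling arise from [put_coord], by inserting the [k]-th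
    coordinate of [X] or that of [X']; a function of the sequence becomes a
    function on a product space. *)
Definition put_coord (x : T_off * E k) : prodE E := eqtype.dfwith (X x.1) x.2.

Lemma measurable_put_coord : measurable_fun [set: T_off * E k] put_coord.
Proof.
apply: measurable_fun_prodE => n; rewrite /put_coord.
have [<-|kn] := eqVneq k n.
  by under eq_fun do rewrite eqtype.dfwith_in; exact: measurable_snd.
under eq_fun do rewrite eqtype.dfwith_out//.
have nk : [set~ k] n by move=> /= nk; rewrite nk eqxx in kn.
exact: (measurableT_comp (measurable_sigX_coord nk)).
Qed.

Lemma put_coord_X w : put_coord (with_coord X w) = X w.
Proof.
apply: functional_extensionality_dep => n; rewrite /put_coord /=.
by case: eqtype.dfwithP.
Qed.

Lemma put_coord_X' w : put_coord (with_coord X' w) = resample X X' k w.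
Proof.
apply: functional_extensionality_dep => n; rewrite /put_coord /resample /=.
have [->|nk] := eqVneq n k; first by rewrite eqtype.dfwith_in.
by rewrite eqtype.dfwith_out// eq_sym.
Qed.

Section square_integrable.
Variables (f : prodE E -> R) (f2 : f \in Lfun mu 2%:E).

Let mf : measurable_fun [set: prodE E] f. Proof. by case/Lfun2P : f2. Qed.

Lemma Lfun2_X : f \o X \in Lfun P 2%:E.
Proof. by apply/(Lfun2_law (m := mu)) => // A mA; rewrite X_mu. Qed.

Let mfput : measurable_fun [set: T_off * E k] (f \o put_coord).
Proof. exact: (measurableT_comp mf measurable_put_coord). Qed.

Lemma Lfun2_put_coord : f \o put_coord \in Lfun (P_off \x mu_ k)%E 2%:E.
Proof.
apply/(Lfun2_law with_coord_X_law) => //.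
rewrite (_ : _ \o _ = f \o X); first exact: Lfun2_X.
by apply/funext => w /=; rewrite put_coord_X.
Qed.

Lemma Lfun2_resample : f \o resample X X' k \in Lfun P 2%:E.
Proof.
have /(Lfun2_law with_coord_X'_law mfput) := Lfun2_put_coord.
rewrite (_ : _ \o _ = f \o resample X X' k)//.
by apply/funext => w /=; rewrite put_coord_X'.
Qed.

End square_integrable.
End resampling.

Section resampling.
Context (R : realType) (d : nat -> measure_display)
  (E : forall n, measurableType (d n)) (mu_ : forall n, probability (E n) R)
  (mu : probability (prodE E) R) (mu_prod : is_product_measure mu_ mu)
  (d0 : measure_display) (T : measurableType d0) (P : probability T R)
  (X X' : {RV P >-> prodE E}).
Hypotheses (X_mu : has_distribution X mu) (X'_mu : has_distribution X' mu)
  (X_X'_indep : independent2 X X').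
Variable k : nat.
Local Notation T_off := (T_off X k).
Local Notation P_off := (P_off X k).

(** An explicit conditional expectation given [G_k]: the mean over the [k]-th
    coordinate. *)
Definition coord_mean (f : prodE E -> R) : T_off -> R :=
  noise_mean (mu_ k) (f \o put_coord (X := X) (k := k)).

Section one_function.
Variables (f : prodE E -> R) (f2 : f \in Lfun mu 2%:E).
Local Notation a := (f \o put_coord (X := X) (k := k)).
Local Notation M := [the probability _ _ of (P_off \x mu_ k)%E].

Let mf : measurable_fun [set: prodE E] f. Proof. by case/Lfun2P : f2. Qed.

Let ia : (P_off \x mu_ k)%E.-integrable [set: T_off * E k] (EFin \o a).
Proof.
apply/Lfun1_integrable.
apply: Lfun_subset12 (Lfun2_put_coord mu_prod X_mu _ f2).
by rewrite [X in X \is a _](probability_setT M).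
Qed.

Lemma measurable_coord_mean : measurable_fun [set: T_off] (coord_mean f).
Proof.
apply: (@measurableT_comp _ _ _ _ _ _ fine) => //.
exact: measurable_fubini_F ia.
Qed.

Lemma integrable_coord_mean :
  P_off.-integrable [set: T_off] (EFin \o coord_mean f).
Proof.
have iF := integrable_fubini_F ia.
apply: le_integrable iF => //.
  by apply/measurable_EFinP; exact: measurable_coord_mean.
(* Where the inner integral is infinite its real part is 0. *)
move=> s _ /=; rewrite /coord_mean /noise_mean /Rintegral /fubini_F /=.
by case: (integral _ _ _) => [r| |] //=; rewrite leey.
Qed.

(** Fubini's theorem for the function [f] times the indicator of an event that
    depends on the first factor only. *)
Lemma is_condexp_coord_mean (F : T -> R) : measurable_fun [set: T] F ->
  {ae P, forall w, F w = f (X w)} -> is_condexp P (cG X k) F (coord_mean f).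
Proof.
move=> mF FfX; have mcG := @sigX_measurable _ _ _ _ _ P X [set~ k].
have icT := integrable_sub_id integrable_coord_mean.
split=> // [|A GA]; first exact: measurable_coord_mean.
have mA : measurable A := sub_sigma_measurable mcG GA.
have mfX : measurable_fun [set: T] (f \o X) by exact: measurableT_comp.
rewrite [RHS](ae_eq_integral_EFin _ _ _ FfX)//.
pose g (x : T_off * E k) := a x * \1_A x.1.
have mA1 : measurable_fun [set: T_off * E k]
    (fun x : T_off * E k => \1_A x.1 : R).
  exact: (@measurableT_comp _ _ _ _ _ _ (\1_A : T_off -> R)).
have mg : measurable_fun [set: T_off * E k] g.
  apply: measurable_funM => //; apply/measurable_EFinP.
  exact: measurable_int ia.
have ig : (P_off \x mu_ k)%E.-integrable [set: T_off * E k] (EFin \o g).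
  apply: le_integrable ia => //; first exact/measurable_EFinP.
  move=> x _ /=; rewrite lee_fin normrM ler_piMr// indicE.
  by case: (_ \in _); rewrite ?normr1 ?normr0.
have mgE : measurable_fun [set: T_off * E k] (EFin \o g).
  by apply/measurable_EFinP.
have law := with_coord_X_law mu_prod X_mu (k := k).
have igT := (integrable_law law mgE).1 ig.
have gX w : g (with_coord X k X w) = f (X w) * \1_A w.
  by rewrite /g /= put_coord_X.
have phi1T : P.-integrable [set: T]
    (EFin \o (fun w => coord_mean f w * \1_A w)).
  apply: le_integrable icT => //.
    apply/measurable_EFinP/measurable_funM => //.
    exact: (measurable_fun_sub mcG measurable_coord_mean).
  move=> x _ /=; rewrite lee_fin normrM ler_piMr// indicE.
  by case: (_ \in _); rewrite ?normr1 ?normr0.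
transitivity (\int[P]_w (coord_mean f w * \1_A w)%:E)%E.
  by rewrite integral_mkcond; apply: eq_integral => w _; rewrite epatch_indic.
transitivity (\int[P]_w (g (with_coord X k X w))%:E)%E; last first.
  rewrite [RHS]integral_mkcond; apply: eq_integral => w _.
  by rewrite epatch_indic gX.
have m1 : measurable_fun [set: T_off]
    (fun w : T_off => coord_mean f w * \1_A w).
  by apply: measurable_funM => //; exact: measurable_coord_mean.
rewrite -(@integral_sub_id _ _ _ _ _ mcG)//; last 2 first.
- exact: (@measurableT _ T_off).
- by apply/measurable_EFinP.

rewrite -[RHS](integral_law law mgE igT).
have E1 := integral12_prod_meas1 ig.
apply: (etrans _ E1); apply: ae_eq_integral => //.
- exact/measurable_EFinP.
- exact: measurable_fubini_F ig.
- have := ae_integrable1 ia; apply: filterS => s ias _.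
  rewrite /fubini_F /g /= EFinM /coord_mean /noise_mean /Rintegral.
  rewrite fineK; last exact: integrable_fin_num.
  by rewrite -integralZr//; apply: eq_integral => z _; rewrite EFinM.
Qed.
End one_function.

(** [covariance_fresh_noise] read on the sample space.  The functions [U] and
    [V] stand for the [k]-th slices of [DF] and [DG]; that these are
    square-integrable makes the integrals of Fubini's theorem finite. *)
Lemma resampling_covariance (f g : prodE E -> R) (U V : T -> R) :
  f \in Lfun mu 2%:E -> g \in Lfun mu 2%:E ->
  U \in Lfun P 2%:E -> V \in Lfun P 2%:E ->
  {ae P, forall w, U w = f (X w) - coord_mean f w} ->
  {ae P, forall w, V w = g (X w) - coord_mean g w} ->
  (\int[P]_w ((f (resample X X' k w) - f (X w)) *
              (g (resample X X' k w) - g (X w)))%:E =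
   2%:E * \int[P]_w (U w * V w)%:E)%E.
Proof.
move=> f2 g2 U2 V2 Uf Vg.
pose a := f \o put_coord (X := X) (k := k).
pose b := g \o put_coord (X := X) (k := k).
have mf : measurable_fun [set: prodE E] f by case/Lfun2P : f2.
have mg : measurable_fun [set: prodE E] g by case/Lfun2P : g2.
have mU : measurable_fun [set: T] U by case/Lfun2P : U2.
have mV : measurable_fun [set: T] V by case/Lfun2P : V2.
have ma : measurable_fun [set: T_off * E k] a.
  by apply: (measurableT_comp mf); exact: measurable_put_coord.
have mb : measurable_fun [set: T_off * E k] b.
  by apply: (measurableT_comp mg); exact: measurable_put_coord.
pose r := fun y : T_off * E k * E k =>
  (a (y.1.1, y.2) - a y.1) * (b (y.1.1, y.2) - b y.1).
have rE w : r (with_coords X X' k w) = (f (resample X X' k w) - f (X w)) *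
              (g (resample X X' k w) - g (X w)).
  by rewrite /r /a /b /= !put_coord_X !put_coord_X'.
pose c := fun x : T_off * E k =>
  (a x - noise_mean (mu_ k) a x.1) * (b x - noise_mean (mu_ k) b x.1).
have cE w : c (with_coord X k X w) =
    (f (X w) - coord_mean f w) * (g (X w) - coord_mean g w).
  by rewrite /c /a /b /= !put_coord_X.
have UVc : {ae P, forall w, U w * V w = c (with_coord X k X w)}.
  by move: Uf Vg; apply: filterS2 => w Uw Vw; rewrite cE Uw Vw.
have mr : measurable_fun [set: T_off * E k * E k] (EFin \o r).
  apply/measurable_EFinP/measurable_funM; apply: measurable_funB.
  - apply: (measurableT_comp ma); apply: measurable_fun_pair => //.
    exact: measurableT_comp.
  - exact: measurableT_comp.
  - apply: (measurableT_comp mb); apply: measurable_fun_pair => //.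
    exact: measurableT_comp.
  - exact: measurableT_comp.
have mc : measurable_fun [set: T_off * E k] c.
  apply: measurable_funM; apply: measurable_funB => //.
  - by apply: (@measurableT_comp _ _ _ _ _ _ (coord_mean f)) => //;
      exact: measurable_coord_mean.
  - by apply: (@measurableT_comp _ _ _ _ _ _ (coord_mean g)) => //;
      exact: measurable_coord_mean.
have mcE : measurable_fun [set: T_off * E k] (EFin \o c).
  by apply/measurable_EFinP.
have /Lfun1_integrable iUV := Lfun2_mul_Lfun1 U2 V2.
have mcT : measurable_fun [set: T] (c \o with_coord X k X).
  exact: measurableT_comp.
have icT : P.-integrable [set: T] ((EFin \o c) \o with_coord X k X).
  exact: (ae_eq_integrable _ UVc iUV).
have irT : P.-integrable [set: T] ((EFin \o r) \o with_coords X X' k).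
  have /Lfun1_integrable := Lfun2_mul_Lfun1
    (Lfun2B (Lfun2_resample mu_prod X_mu X'_mu X_X'_indep k f2)
      (Lfun2_X X_mu f2))
    (Lfun2B (Lfun2_resample mu_prod X_mu X'_mu X_X'_indep k g2)
      (Lfun2_X X_mu g2)).
  by apply: eq_integrable => // w _ /=; rewrite rE.
have law1 := with_coord_X_law mu_prod X_mu (k := k).
have law2 := with_coords_law mu_prod X_mu X'_mu X_X'_indep (k := k).
have ic := (integrable_law law1 mcE).2 icT.
have ir := (integrable_law law2 mr).2 irT.
have a2 : a \in Lfun (P_off \x mu_ k)%E 2%:E.
  exact: (Lfun2_put_coord mu_prod X_mu k f2).
have b2 : b \in Lfun (P_off \x mu_ k)%E 2%:E.
  exact: (Lfun2_put_coord mu_prod X_mu k g2).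
have := covariance_fresh_noise a2 b2 ic ir.
rewrite (integral_law law2 mr irT) (integral_law law1 mcE icT) => cov.
transitivity (\int[P]_w (r (with_coords X X' k w))%:E)%E.
  by apply: eq_integral => w _; rewrite rE.
apply: (etrans cov); congr (_ * _)%E.
apply: ae_eq_integral_EFin => //; first exact: measurable_funM.
by apply: filterS UVc => w ->.
Qed.

End resampling.

(** * The closure of the difference operator *)

Section closure.
Context (R : realType) (d : nat -> measure_display)
  (E : forall n, measurableType (d n))
  (d0 : measure_display) (T : measurableType d0) (P : probability T R)
  (X : {RV P >-> prodE E}).
Local Notation TF := (g_sigma_algebraType (cF X)).

Lemma PF_law A : measurable A -> PF X A = distribution P (toF X) A.
Proof. by []. Qed.

Lemma measurable_fun_cF d' (S : measurableType d') (h : TF -> S) :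
  measurable_fun [set: TF] h -> measurable_fun [set: T] (h : T -> S).
Proof.
by move=> mh; apply: (measurableT_comp mh (@measurable_toF _ _ _ _ _ P X)).
Qed.

Lemma Lfun2_PF (h : TF -> R) : h \in Lfun (PF X) 2%:E ->
  (h : T -> R) \in Lfun P 2%:E.
Proof. by move=> h2; apply/(Lfun2_law PF_law) => //; case/Lfun2P : h2. Qed.

Lemma L2X_Lfun2 (F : L2X X) : (F : T -> R) \in Lfun P 2%:E.
Proof. by apply: Lfun2_PF; exact: LfunP. Qed.

Lemma L2X_integrable (F : L2X X) : P.-integrable [set: T] (EFin \o F).
Proof.
apply/Lfun1_integrable; apply: Lfun_subset12 (L2X_Lfun2 F).
by rewrite [X in X \is a _](probability_setT P).
Qed.

Lemma integral_abs_PF (h : TF -> R) : measurable_fun [set: TF] h ->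
  (\int[P]_w `|h w|%:E <= 'N[PF X]_2%:E[EFin \o h])%E.
Proof.
move=> mh; apply: le_trans (integral_abs_le_Lnorm2 (PF X) mh).
rewrite (ge0_integral_law PF_law)//.
by apply/measurable_EFinP; exact: measurableT_comp.
Qed.

(** For an approximating sequence [F_n], [U_n] of the closure, the slice
    [U_n (k, .)] is [F_n - E[F_n | G_k]].  So the [L^1] distance between
    [U (k, .)] and [F - E[F | G_k]] is at most the distance from [U_n] to [U]
    plus twice the one from [F_n] to [F]. *)
Lemma closure_slice (F : L2X X) (U : L2 (kappaPF X)) k : D (F, U) ->
  {ae P, forall w : T, U (k, w) = D_ X k F w}.
Proof.
move=> [u [u0 /= cvgF cvgU]].
have mcG := @sigX_measurable _ _ _ _ _ P X [set~ k].
pose H (G : L2X X) := condexp P (cG X k) G.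
have HP (G : L2X X) : is_condexp P (cG X k) G (H G).
  exact: (condexpP mcG (L2X_integrable G)).
have mH (G : L2X X) : measurable_fun [set: T] (H G).
  by have [mHG _ _] := HP G; exact: (measurable_fun_sub mcG mHG).
have mL (G : L2X X) : measurable_fun [set: T] (G : T -> R).
  by case/Lfun2P : (L2X_Lfun2 G).
have mUF (V : L2 (kappaPF X)) : measurable_fun [set: TF] (fun w => V (k, w)).
  exact: measurable_fun_pair2.
have mU (V : L2 (kappaPF X)) : measurable_fun [set: T] (fun w => V (k, w)).
  exact: (measurable_fun_cF (mUF V)).
have mE (h : T -> R) : measurable_fun [set: T] h ->
    measurable_fun [set: T] (fun w => `|h w|%:E).
  by move=> mh; apply/measurable_EFinP; exact: measurableT_comp.
pose bound n := ('N[kappaPF X]_2%:E[EFin \o (fun x => (u n).2 x - U x)%R] +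
  ('N[PF X]_2%:E[EFin \o (fun x => (u n).1 x - F x)%R] +
   'N[PF X]_2%:E[EFin \o (fun x => (u n).1 x - F x)%R]))%E.
have cvg_bound : bound n @[n --> \oo] --> 0%E.
  rewrite -[0%E]adde0; apply: cvgeD => //.
  by rewrite -[0%E]adde0; apply: cvgeD.
have le_bound n : (\int[P]_w `|U (k, w) - D_ X k F w|%:E <= bound n)%E.
  have [_ uD] := u0 n.
  set Fn := (u n).1; set Un := (u n).2.
  apply: (@le_trans _ _ (\int[P]_w (`|Un (k, w) - U (k, w)|%:E +
      (`|Fn w - F w|%:E + `|H Fn w - H F w|%:E)))%E).
    apply: ae_ge0_le_integral => //.
    - apply: mE; exact: measurable_funB (mU U) (measurable_funB (mL F) (mH F)).
    - by move=> x _; rewrite !adde_ge0.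
    - apply: emeasurable_funD.
        exact: (mE _ (measurable_funB (mU Un) (mU U))).
      apply: emeasurable_funD.
        exact: (mE _ (measurable_funB (mL Fn) (mL F))).
      exact: (mE _ (measurable_funB (mH Fn) (mH F))).
    - have Unk : {ae P, forall w : T, Un (k, w) = D_ X k Fn w} := uD k.
      apply: filterS Unk => w Unw _.
      rewrite -!EFinD lee_fin.
      have -> : U (k, w) - D_ X k F w =
          - (Un (k, w) - U (k, w)) + ((Fn w - F w) - (H Fn w - H F w)).
        rewrite Unw /D_ /H /Fn; ring.
      rewrite (le_trans (ler_normD _ _))// normrN lerD2l.
      exact: ler_normB.
  rewrite ge0_integralD//; last 3 first.
  - exact: (mE _ (measurable_funB (mU Un) (mU U))).
  - by move=> w _; rewrite adde_ge0.
  - by apply: emeasurable_funD; [exact: (mE _ (measurable_funB (mL Fn) (mL F)))|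
      exact: (mE _ (measurable_funB (mH Fn) (mH F)))].
  apply: leeD.
    have mW : measurable_fun [set: nat * TF] (fun x => Un x - U x).
      exact: measurable_funB.
    apply: (le_trans (integral_abs_PF (measurable_funB (mUF Un) (mUF U)))).
    exact: (@Lnorm2_slice _ _ _ (PF X) _ k mW).
  rewrite ge0_integralD//; last 2 first.
  - exact: (mE _ (measurable_funB (mL Fn) (mL F))).
  - exact: (mE _ (measurable_funB (mH Fn) (mH F))).
  have FnF : (\int[P]_w `|Fn w - F w|%:E <=
      'N[PF X]_2%:E[EFin \o (fun x => Fn x - F x)%R])%E.
    by apply: integral_abs_PF; exact: measurable_funB.
  apply: leeD => //; apply: le_trans FnF.
  exact: (le_abs_condexpB mcG (L2X_integrable _) (L2X_integrable _)
    (HP _) (HP _)).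
have mUD : measurable_fun [set: T] (fun w => U (k, w) - D_ X k F w).
  exact: (measurable_funB (mU U) (measurable_funB (mL F) (mH F))).
have mUDE : measurable_fun [set: T] (EFin \o (fun w => U (k, w) - D_ X k F w)).
  exact/measurable_EFinP.
have [ae0 _] := ae_eq_integral_abs P measurableT mUDE.
have /ae0 : (\int[P]_w `|(EFin \o (fun w => U (k, w) - D_ X k F w)%R) w| = 0)%E.
  apply/eqP; rewrite eq_le integral_ge0// andbT.
  by apply: cvge_ge cvg_bound; apply: nearW.
apply: filterS => w /(_ I) /= [] /eqP.
by rewrite subr_eq0 => /eqP.
Qed.
End closure.

(** * Integration by parts *)

Section integration_by_parts.
Context (R : realType) (d : nat -> measure_display)
  (E : forall n, measurableType (d n)) (mu_ : forall n, probability (E n) R)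
  (mu : probability (prodE E) R) (mu_prod : is_product_measure mu_ mu)
  (d0 : measure_display) (T : measurableType d0) (P : probability T R)
  (X X' : {RV P >-> prodE E}).
Hypotheses (X_mu : has_distribution X mu) (X'_mu : has_distribution X' mu)
  (X_X'_indep : independent2 X X').

Lemma D_coord_mean (F : L2X X) (U : L2 (kappaPF X)) (f : L2 mu) k :
  D (F, U) -> representative F f ->
  {ae P, forall w : T,
    U (k, w) = f (X w) - coord_mean mu_ (X := X) (k := k) f w}.
Proof.
move=> FU Ff.
have f2 : (f : prodE E -> R) \in Lfun mu 2%:E by exact: LfunP.
have FfX : {ae P, forall w : T, F w = f (X w)} := Ff.
have mF : measurable_fun [set: T] (F : T -> R) by case/Lfun2P : (L2X_Lfun2 F).
have mcG := @sigX_measurable _ _ _ _ _ P X [set~ k].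
have cF1 := condexpP mcG (L2X_integrable F).
have cF2 := is_condexp_coord_mean mu_prod X_mu k f2 mF FfX.
have := condexp_unique mcG (L2X_integrable F) cF1 cF2.
have UF := closure_slice k FU.
move: UF FfX; apply: filterS3 => w Uw Fw Hw.
by rewrite Uw /D_ Fw -Hw.
Qed.

Lemma Lfun2_PF_slice (U : L2 (kappaPF X)) k :
  (fun w : T => U (k, w)) \in Lfun P 2%:E.
Proof.
by apply: Lfun2_PF; apply: Lfun2_slice => //; exact: LfunP.
Qed.

Lemma integral_PF (h : g_sigma_algebraType (cF X) -> R) :
  measurable_fun [set: g_sigma_algebraType (cF X)] h ->
  P.-integrable [set: T] (EFin \o h) ->
  (\int[PF X]_w (h w)%:E = \int[P]_w (h w)%:E)%E.
Proof.
move=> mh hi; apply: (integral_law (@PF_law _ _ _ _ _ _ X)) => //.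
exact/measurable_EFinP.
Qed.

Lemma inner_slices (U V : L2 (kappaPF X)) :
  (\sum_(0 <= k < n) \int[P]_w (U (k, w) * V (k, w))%:E)%E @[n --> \oo] -->
  (inner U V)%:E.
Proof.
have /Lfun1_integrable iUV := Lfun2_mul_Lfun1 (LfunP U) (LfunP V).
have [_] := sum_integral_slices iUV.
rewrite /inner fineK; last exact: integrable_fin_num.
have E1 k : (\int[PF X]_w (U (k, w) * V (k, w))%:E =
    \int[P]_w (U (k, w) * V (k, w))%:E)%E.
  apply: (@integral_PF (fun w => U (k, w) * V (k, w))).
    by apply: measurable_funM; exact: measurable_fun_pair2.
  have := Lfun2_mul_Lfun1 (Lfun2_PF_slice U k) (Lfun2_PF_slice V k).
  by move=> /Lfun1_integrable.
by under eq_fun do under eq_bigr do rewrite E1.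
Qed.

Lemma sum_sqr_slices (U : L2 (kappaPF X)) :
  (\sum_(k <oo) \int[P]_w (U (k, w) ^+ 2)%:E < +oo)%E.
Proof.
have iU2 := Lfun2_integrable_sqr (LfunP U).
have [+ _] := sum_integral_slices iU2.
apply: le_lt_trans; apply: lee_nneseries => [k _ _|k _].
  by apply: integral_ge0 => w _; rewrite lee_fin sqr_ge0.
rewrite le_eqVlt; apply/orP; left; apply/eqP.
rewrite (@ge0_integral_law _ _ _ _ _ _ _ _ (@PF_law _ _ _ _ _ _ X)
  (fun w => `|U (k, w) ^+ 2|%:E))//.
  by apply: eq_integral => w _; rewrite ger0_norm ?sqr_ge0.
apply/measurable_EFinP/measurableT_comp => //; apply: measurable_funX.
exact: measurable_fun_pair2.
Qed.

(** Both sides are limits of partial sums, and up to the factor 2 the terms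
    agree by [resampling_covariance]. *)
Lemma expectation_Gamma0 (F G : L2X X) (U V : L2 (kappaPF X)) (f g : L2 mu) :
  D (F, U) -> D (G, V) -> representative F f -> representative G g ->
  ('E_P[Gamma0 X X' f g] = (inner U V)%:E)%E.
Proof.
move=> FU GV Ff Gg.
have mcF := @sigX_measurable _ _ _ _ _ P X setT.
have f2 : (f : prodE E -> R) \in Lfun mu 2%:E by exact: LfunP.
have g2 : (g : prodE E -> R) \in Lfun mu 2%:E by exact: LfunP.
pose df k w := f (resample X X' k w) - f (X w).
pose dg k w := g (resample X X' k w) - g (X w).
have df2 k : df k \in Lfun P 2%:E.
  exact: Lfun2B (Lfun2_resample mu_prod X_mu X'_mu X_X'_indep k f2)
    (Lfun2_X X_mu f2).
have dg2 k : dg k \in Lfun P 2%:E.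
  exact: Lfun2B (Lfun2_resample mu_prod X_mu X'_mu X_X'_indep k g2)
    (Lfun2_X X_mu g2).
pose r k w := df k w * dg k w.
have ir k : P.-integrable [set: T] (EFin \o r k).
  by apply/Lfun1_integrable; exact: Lfun2_mul_Lfun1.
pose h k := condexp P (cF X) (r k).
have hP k : is_condexp P (cF X) (r k) (h k) by exact: condexpP.
have ih k : P.-integrable [set: T] (EFin \o h k) by have [] := hP k.
have rUV k : (\int[P]_w (r k w)%:E =
    2%:E * \int[P]_w (U (k, w) * V (k, w))%:E)%E.
  exact: (resampling_covariance mu_prod X_mu X'_mu X_X'_indep f2 g2
    (Lfun2_PF_slice U k) (Lfun2_PF_slice V k)
    (D_coord_mean k FU Ff) (D_coord_mean k GV Gg)).
have df2E k : (\int[P]_w (df k w ^+ 2)%:E =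
    2%:E * \int[P]_w (U (k, w) ^+ 2)%:E)%E.
  have := resampling_covariance mu_prod X_mu X'_mu X_X'_indep f2 f2
    (Lfun2_PF_slice U k) (Lfun2_PF_slice U k)
    (D_coord_mean k FU Ff) (D_coord_mean k FU Ff).
  under eq_integral do rewrite -expr2.
  by under [in X in _ = X -> _]eq_integral do rewrite -expr2.
have dg2E k : (\int[P]_w (dg k w ^+ 2)%:E =
    2%:E * \int[P]_w (V (k, w) ^+ 2)%:E)%E.
  have := resampling_covariance mu_prod X_mu X'_mu X_X'_indep g2 g2
    (Lfun2_PF_slice V k) (Lfun2_PF_slice V k)
    (D_coord_mean k GV Gg) (D_coord_mean k GV Gg).
  under eq_integral do rewrite -expr2.
  by under [in X in _ = X -> _]eq_integral do rewrite -expr2.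
have h_le k : (\int[P]_w `|h k w|%:E <=
    \int[P]_w (U (k, w) ^+ 2)%:E + \int[P]_w (V (k, w) ^+ 2)%:E)%E.
  apply: (le_trans (le_abs_condexp mcF (ir k) (hP k))).
  have /Lfun2_integrable_sqr idf := df2 k.
  have /Lfun2_integrable_sqr idg := dg2 k.
  have ihalf (u : T -> R) : P.-integrable [set: T] (EFin \o u) ->
      P.-integrable [set: T] (EFin \o (fun w => 2^-1 * u w)).
    exact: (integrableZl measurableT (2^-1 : R)).
  apply: (@le_trans _ _
      (\int[P]_w (2^-1 * df k w ^+ 2 + 2^-1 * dg k w ^+ 2)%:E)%E).
    apply: le_integral => //.
    - exact: integrable_abse (ir k).
    - exact: (integrableD measurableT (ihalf _ idf) (ihalf _ idg)).
    - by move=> w _; rewrite lee_fin /r; exact: normrM_le_half_sqr.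
  have half (u : T -> R) c : P.-integrable [set: T] (EFin \o u) ->
      (\int[P]_w (u w)%:E = 2%:E * c -> \int[P]_w (2^-1 * u w)%:E = c)%E.
    move=> iu uc; transitivity (2^-1%:E * \int[P]_w (u w)%:E)%E.
      by rewrite -integralZl//; apply: eq_integral.
    by rewrite uc muleA -EFinM mulVf// mul1e.
  rewrite integralD_EFin//; [|exact: ihalf..].
  by rewrite [X in (X + _)%E](half _ _ idf (df2E k))
    [X in (_ + X)%E](half _ _ idg (dg2E k)).
have sumh : (\sum_(k <oo) \int[P]_w `|h k w|%:E < +oo)%E.
  apply: (@le_lt_trans _ _ (\sum_(k <oo) (\int[P]_w (U (k, w) ^+ 2)%:E +
      \int[P]_w (V (k, w) ^+ 2)%:E))%E).
    by apply: lee_nneseries => [k _ _|k _]; [exact: integral_ge0|exact: h_le].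
  rewrite nneseriesD; last 2 first.
  - by move=> k _ _; apply: integral_ge0 => w _; rewrite lee_fin sqr_ge0.
  - by move=> k _ _; apply: integral_ge0 => w _; rewrite lee_fin sqr_ge0.
  by rewrite lte_add_pinfty// sum_sqr_slices.
have [iL cL] := cvg_integral_series ih sumh.
have EL : (\int[P]_w (limn (series (h ^~ w)))%:E = 2%:E * (inner U V)%:E)%E.
  apply: (cvg_unique _ cL) => //.
  have hE k : (\int[P]_w (h k w)%:E =
      2%:E * \int[P]_w (U (k, w) * V (k, w))%:E)%E.
    have [_ _ hint] := hP k; rewrite hint ?rUV//.
    exact: (@measurableT _ (g_sigma_algebraType (cF X))).
  have cE k : (\int[P]_w (U (k, w) * V (k, w))%:E =
      (\int[P]_w (U (k, w) * V (k, w))%R)%:E)%E.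
    have /Lfun1_integrable iUV :=
      Lfun2_mul_Lfun1 (Lfun2_PF_slice U k) (Lfun2_PF_slice V k).
    by rewrite fineK//; exact: integrable_fin_num iUV.
  rewrite (_ : (fun n => _) = (fun n => 2%:E *
      \sum_(0 <= k < n) \int[P]_w (U (k, w) * V (k, w))%:E)%E); last first.
    apply/funext => n; under eq_bigr do rewrite hE cE -EFinM.
    by under [in RHS]eq_bigr do rewrite cE; rewrite !sumEFin -EFinM mulr_sumr.
  by apply: cvgeZl => //; exact: inner_slices.
rewrite unlock /Gamma0 /=.
rewrite (eq_integral (fun w => 2^-1%:E * (limn (series (h ^~ w)))%:E)%E)//.
by rewrite integralZl// EL -!EFinM mulrA mulVf// mul1r.
Qed.

End integration_by_parts.

Theorem proposition2p12 (R : realType)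
  (d : nat -> measure_display) (E : forall n, measurableType (d n))
  (mu_ : forall n, probability (E n) R)
  (mu : probability (prodE E) R)
  (mu_prod : is_product_measure mu_ mu)
  (d0 : measure_display) (T : measurableType d0) (P : probability T R)
  (X X' : {RV P >-> prodE E})
  (X_mu : has_distribution X mu) (X'_mu : has_distribution X' mu)
  (X_X'_indep : independent2 X X')
  (F G : L2X X) (F_dom : domD F) (G_dom : domL G)
  (f g : L2 mu) (F_f : representative F f) (G_g : representative G g) :
  ('E_P[fun w => (F w * L G w)%R] = - 'E_P[Gamma0 X X' f g])%E.
Proof.
pose DX := @D _ _ _ _ _ P X; pose deltaX := @delta _ _ _ _ _ P X.
have FU : D (F, op_app DX F) by exact: xgetPex F_dom.
have [G_domD G_domdelta] := G_dom.
have GV : D (G, op_app DX G) by exact: xgetPex G_domD.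
have Vh : deltaX (op_app DX G, op_app deltaX (op_app DX G)).
  exact: xgetPex G_domdelta.
rewrite (expectation_Gamma0 mu_prod X_mu X'_mu X_X'_indep FU GV F_f G_g).
set h := op_app deltaX (op_app DX G) in Vh *.
(* The adjoint relation moves [D] away from [F]. *)
rewrite -(Vh F F_dom) /=.
have /Lfun1_integrable iFh := Lfun2_mul_Lfun1 (L2X_Lfun2 F) (L2X_Lfun2 h).
have inner_E : (\int[P]_w (F w * h w)%:E = (inner F h)%:E)%E.
  rewrite /inner fineK; last first.
    by apply: integrable_fin_num => //; apply/Lfun1_integrable;
      exact: Lfun2_mul_Lfun1 (LfunP F) (LfunP h).
  apply/esym/(@integral_PF _ _ _ _ _ P X (fun w => F w * h w)) => //.
  exact: measurable_funM.
rewrite unlock EFinN -inner_E -integralN//; last exact: integrable_add_def.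
by apply: eq_integral => w _; rewrite -EFinN -mulrN.
Qed.
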